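(* Let $p$ be an odd prime and $e$ a positive integer with $e\equiv0\pmod4$ and $p\mid e$; put $q=p^e$. For $i\in\{0,1\}$ let $D_i=\{x\in\mathbb{F}_q:\mathrm{Tr}(x^{p+1}-x)\in C_i^{(2,p)}\}$ and $\mathcal{C}_{D_i}=\{(\mathrm{Tr}(ax))_{x\in D_i}:a\in\mathbb{F}_q\}$. Then $\mathcal{C}_{D_i}$ has length $\frac{p-1}{2}p^{e-1}+\frac{p-1}{2}p^{\frac e2}$ and dimension $e$, it has at most $5$ nonzero weights, and its weight distribution is (weight: number of codewords), with $W=\frac{(p-1)^2}{2}p^{e-2}$: - $0$: $1$; - $W+\frac{(p-1)^2}{2}p^{\frac e2-1}$: $p^e-p^{e-2}$; - $W$: $\frac{p+1}{2}p^{e-4}-1-\frac{p-1}{2}p^{\frac e2-2}$; - $W+\frac{p-1}{2}p^{\frac e2}$: $\frac{p^2-1}{2}p^{e-4}$; - $W+(p-1)p^{\frac e2}$: $\frac{p-1}{2}p^{e-4}+\frac{p-1}{2}p^{\frac e2-2}$; - $W+\frac{p-3}{2}p^{\frac e2}$: $\frac{(p-1)^2}{2}p^{e-4}$.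
   Context: $\mathrm{Tr}$ is the absolute trace $\mathbb{F}_q\to\mathbb{F}_p$. $C_0^{(2,p)}$ (resp. $C_1^{(2,p)}$) is the set of squares (resp. non-squares) in $\mathbb{F}_p^*$. Weights are Hamming weights. *)

(* Defs.v *)
From HB Require Import structures.
From mathcomp Require Import all_boot all_order all_algebra all_field.
Set Implicit Arguments. Unset Strict Implicit. Unset Printing Implicit Defensive.
Import GRing.Theory.
Local Open Scope ring_scope.

(* F is a finite field of order q = p^e.  Absolute trace F_q -> F_p, realised
   inside F (its values lie in the prime subfield {s | s^p = s}). *)
Definition Tr (F : finFieldType) (p e : nat) (x : F) : F :=
  \sum_(i < e) x ^+ (p ^ i).

Definition in_Fp (F : finFieldType) (p : nat) (s : F) : bool := s ^+ p == s.

Definition C0 (F : finFieldType) (p : nat) (t : F) : bool :=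
  [exists s : F, [&& @in_Fp F p s, s != 0 & t == s ^+ 2]].

Definition C1 (F : finFieldType) (p : nat) (t : F) : bool :=
  [&& @in_Fp F p t, t != 0 & ~~ @C0 F p t].

Definition Cclass (F : finFieldType) (p : nat) (i : 'I_2) (t : F) : bool :=
  if val i == 0%N then @C0 F p t else @C1 F p t.

Definition Dset (F : finFieldType) (p e : nat) (i : 'I_2) : {set F} :=
  [set x : F | @Cclass F p i (@Tr F p e (x ^+ p.+1 - x))].

(* codeword indexed by a : (Tr(a x))_{x in D_i}, stored as a function on F
   that vanishes outside D_i *)
Definition codeword (F : finFieldType) (p e : nat) (i : 'I_2) (a : F)
  : {ffun F -> F} :=
  [ffun x => if x \in @Dset F p e i then @Tr F p e (a * x) else 0].

Definition code (F : finFieldType) (p e : nat) (i : 'I_2) : {set {ffun F -> F}} :=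
  [set @codeword F p e i a | a : F].

(* Hamming weight of a codeword (support is contained in D_i) *)
Definition wt (F : finFieldType) (c : {ffun F -> F}) : nat :=
  #|[set x : F | c x != 0]|.

Definition nwt (F : finFieldType) (p e : nat) (i : 'I_2) (w : nat) : nat :=
  #|[set c in @code F p e i | wt c == w]|.

Definition tW (p e : nat) : nat := (((p - 1) ^ 2) %/ 2 * p ^ (e - 2))%N.

Definition weights (p e : nat) : seq nat :=
  [:: 0%N;
      (tW p e + ((p - 1) ^ 2) %/ 2 * p ^ (e %/ 2 - 1))%N;
      tW p e;
      (tW p e + (p - 1) %/ 2 * p ^ (e %/ 2))%N;
      (tW p e + (p - 1) * p ^ (e %/ 2))%N;
      (tW p e + (p - 3) %/ 2 * p ^ (e %/ 2))%N ].

Definition freqs (p e : nat) : seq nat :=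
  [:: 1%N;
      (p ^ e - p ^ (e - 2))%N;
      ((p + 1) %/ 2 * p ^ (e - 4) - 1 - (p - 1) %/ 2 * p ^ (e %/ 2 - 2))%N;
      ((p ^ 2 - 1) %/ 2 * p ^ (e - 4))%N;
      ((p - 1) %/ 2 * p ^ (e - 4) + (p - 1) %/ 2 * p ^ (e %/ 2 - 2))%N;
      (((p - 1) ^ 2) %/ 2 * p ^ (e - 4))%N ].

(* Main.v *)
(* Completing the square (here p | e is used) gives Tr(x^{p+1} - x) = Q(x - 1/2)
   for the quadratic form Q(x) = Tr(x^{p+1}), whose polar form B has the radical
   R = {y | y^{p^2} = - y} of order p^2.  No exponential sums are needed:
   - scaling by F_{p^2}^* makes the sizes of the level sets {Q = t} constant on
     t <> 0 and forces |{Q = 0}| = 1 modulo p^2 - 1; together with the number of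
     pairs (x, y) such that Q(x) = Q(y) this determines all of them;
   - for b outside R, translation by the line F_p b then yields the number of y
     with prescribed Q(y) and B(y, b).
   If Tr(a .) does not vanish on R, then it is equidistributed on D_i, which
   gives the second weight.  Otherwise Tr(a .) = B(., b) for some b, unique
   modulo R, and the weight depends only on Tr(b) and on whether - Q(b) lies in
   the class C_i.  As Tr(b) = B(b, 1/2), the frequencies are again counts of y
   with prescribed Q(y) and B(y, 1/2). *)

Require Import Defs.
From HB Require Import structures.
From mathcomp Require Import all_boot all_order all_algebra all_field.
From mathcomp Require Import cyclic ring zify.

Set Implicit Arguments.
Unset Strict Implicit.
Unset Printing Implicit Defensive.

Import GRing.Theory.
Local Open Scope ring_scope.

(** * Counting by fibers *)

Lemma card_sum_fibers (T U : finType) (f : T -> U) (X : {set T}) (Y : {set U}) :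
  {in X, forall x, f x \in Y} ->
  #|X| = (\sum_(y in Y) #|[set x in X | f x == y]|)%N.
Proof.
move=> fXY; rewrite -sum1_card (partition_big f (mem Y)) //=.
by apply: eq_bigr => y _; rewrite -sum1_card; apply: eq_bigl => x; rewrite inE.
Qed.

Lemma card_uniform_fibers (T U : finType) (f : T -> U) (X : {set T}) n :
  {in X, forall x, #|[set y in X | f y == f x]| = n} ->
  #|X| = (#|f @: X| * n)%N.
Proof.
move=> fn; rewrite (@card_sum_fibers _ _ f X (f @: X)); last first.
  by move=> x Xx; apply: imset_f.
rewrite -sum_nat_const; apply: eq_bigr => _ /imsetP[x Xx ->]; exact: fn.
Qed.

Lemma card_set_bij (T : finType) (f g : T -> T) (P R : pred T) :
  cancel f g -> cancel g f -> (forall x, P x = R (f x)) ->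
  #|[set x | P x]| = #|[set x | R x]|.
Proof.
move=> fK gK PR; rewrite -(card_imset _ (can_inj fK)).
apply: eq_card => y; rewrite inE; apply/imsetP/idP.
  by case=> x; rewrite inE PR => ? ->.
by move=> Ry; exists (g y); rewrite ?gK // inE PR gK.
Qed.

Lemma card_set_sum (T : finType) (P : pred T) :
  #|[set x | P x]| = (\sum_x (P x))%N.
Proof. by rewrite -sum1dep_card big_mkcond; apply: eq_bigr => x _; case: (P x). Qed.

(** * Roots of unity in finite fields *)

Section UnityRoots.

Variable F : finFieldType.

Lemma finField_prim_root n : (n %| #|F|.-1)%N ->
  exists z : F, n.-primitive_root z.
Proof.
move=> n_dv; have q_gt1 := finNzRing_gt1 F.
have q1_gt0 : (0 < #|F|.-1)%N by rewrite -ltnS prednK // ltnW.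
have /hasP[z _ pz] : has (#|F|.-1).-primitive_root (enum [set~ (0 : F)]).
  apply: has_prim_root; rewrite ?enum_uniq //; last by rewrite -cardE cardsC1.
  apply/allP => x; rewrite mem_enum !inE => x0; apply/unity_rootP.
  by apply: (mulfI x0); rewrite -exprS prednK ?expf_card ?mulr1 // ltnW.
by exists (z ^+ (#|F|.-1 %/ n)); apply: dvdn_prim_root.
Qed.

Lemma card_unity_roots n : (n %| #|F|.-1)%N -> #|[set x : F | x ^+ n == 1]| = n.
Proof.
case/finField_prim_root => z pz; rewrite -[RHS]card_ord.
have inj : injective (fun i : 'I_n => z ^+ i).
  move=> i j /eqP; rewrite (eq_prim_root_expr pz) !modn_small // => /eqP.
  exact: val_inj.
rewrite -(card_imset _ inj); apply: eq_card => x; rewrite inE.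
apply/eqP/imsetP => [/(prim_rootP pz)[i ->] | [i _ ->]]; first by exists i.
by rewrite exprAC (prim_expr_order pz) expr1n.
Qed.

(** Zero joins the roots of unity of order [n]. With [n.+1] a power of [p], this gives the orders of
    the subfields of orders [p] and [p ^ 2]. *)
Lemma card_expr_fixed n : (n %| #|F|.-1)%N -> #|[set x : F | x ^+ n.+1 == x]| = n.+1.
Proof.
move=> n_dv; have n_gt0 : (0 < n)%N.
  by case: n n_dv => // /[!dvd0n]; have := finNzRing_gt1 F; case: #|F| => [|[]].
rewrite -{2}(card_unity_roots n_dv).
have -> : [set x : F | x ^+ n.+1 == x] = 0 |: [set x : F | x ^+ n == 1].
  apply/setP => x; rewrite !inE exprS -[X in _ == X]mulr1.
  by have [->|x0] := eqVneq x 0; rewrite ?mul0r ?eqxx // (inj_eq (mulfI x0)).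
by rewrite cardsU1 inE expr0n gtn_eqF // eq_sym oner_eq0.
Qed.

Lemma prim_root_neq0 n (z : F) : n.-primitive_root z -> z != 0.
Proof.
by move=> pz; rewrite (prim_root_eq0 pz) -lt0n (prim_order_gt0 pz).
Qed.

(** The powers of [z] act freely on [X], and the orbits are exactly the fibers of [x ^+ n] on [X],
    so each fiber has [n] elements. *)
Lemma prim_root_dvd_card n (z : F) (X : {set F}) : n.-primitive_root z ->
  0 \notin X -> {in X, forall x, z * x \in X} -> (n %| #|X|)%N.
Proof.
move=> pz X0 Xz; have XzX i x : x \in X -> z ^+ i * x \in X.
  by elim: i => [|i IH] Xx; rewrite ?mul1r // exprS -mulrA; apply/Xz/IH.
rewrite (@card_uniform_fibers _ _ (fun x => x ^+ n) X n) ?dvdn_mull // => x Xx.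
have x0 : x != 0 by apply: contraNneq X0 => <-.
have inj : injective (fun i : 'I_n => z ^+ i * x).
  move=> i j /(mulIf x0) /eqP.
  by rewrite (eq_prim_root_expr pz) !modn_small // => /eqP /val_inj.
rewrite -[RHS]card_ord -(card_imset _ inj); apply: eq_card => y; rewrite inE.
apply/andP/imsetP => [[_ /eqP yx] | [i _ ->]]; last first.
  by rewrite XzX // exprMn exprAC (prim_expr_order pz) expr1n mul1r eqxx.
have /(prim_rootP pz)[i yi] : (y / x) ^+ n = 1.
  by rewrite expr_div_n yx divff // expf_neq0.
by exists i; rewrite // -yi divfK.
Qed.

End UnityRoots.

(** * Arithmetic *)

Lemma dvdn_subX1 a n : (a - 1 %| a ^ n - 1)%N.
Proof. by rewrite -[X in (_ %| _ - X)%N](exp1n n) subn_exp dvdn_mulr. Qed.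

(** Writing [p = 2 * h + 1] turns every truncated quotient of the weight and frequency tables into a
    polynomial in [h], as linear arithmetic requires. *)
Lemma odd_halves p : odd p -> (2 < p)%N -> exists2 h : nat,
  [/\ (0 < h)%N, p = (2 * h + 1)%N & ((p - 1) %/ 2 = h)%N] &
  [/\ ((p - 1) ^ 2 %/ 2 = 2 * h * h)%N, ((p + 1) %/ 2 = h + 1)%N,
      ((p ^ 2 - 1) %/ 2 = 2 * h * (h + 1))%N & ((p - 3) %/ 2 = h - 1)%N].
Proof.
move=> p_odd p_gt2; pose h := ((p - 1) %/ 2)%N.
have ph : p = (2 * h + 1)%N by rewrite /h; lia.
exists h; first by split; rewrite /h //; lia.
split; last by rewrite /h; lia.
- have -> : ((p - 1) ^ 2 = 2 * h * h * 2)%N by rewrite -mulnn; nia.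
  by rewrite mulnK.
- by rewrite /h; lia.
have -> : (p ^ 2 - 1 = 2 * h * (h + 1) * 2)%N by rewrite -mulnn; nia.
by rewrite mulnK.
Qed.

(* With [d := p ^ (e - 1) - A1], the two moments force [d ^ 2 = p ^ e]; the
   congruence modulo [p ^ 2 - 1] selects the sign of [d]. *)
Lemma level_sizes_of_moments p n A0 A1 : (1 < p)%N -> (0 < n)%N ->
  (A0 + (p - 1) * A1 = p ^ (4 * n))%N ->
  (A0 * A0 + (p - 1) * (A1 * A1) =
     p ^ 2 * p ^ (4 * n) + (p ^ (4 * n) - p ^ 2) * p ^ (4 * n - 1))%N ->
  (0 < A0)%N -> (p ^ 2 - 1 %| A0 - 1)%N ->
  (A0 + (p - 1) * p ^ (2 * n) = p ^ (4 * n - 1))%N /\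
  (A1 = p ^ (4 * n - 1) + p ^ (2 * n))%N.
Proof.
move=> p_gt1 n_gt0; set X := (p ^ (2 * n))%N; set Y := (p ^ (4 * n - 1))%N.
have XX : (p ^ (4 * n) = X * X)%N by rewrite -expnD; congr (_ ^ _)%N; lia.
have YX : (p * Y = X * X)%N by rewrite -XX -expnS; congr (_ ^ _)%N; lia.
(* Both [X] and [Y / p] are powers of [p ^ 2], hence congruent to 1 modulo [p ^ 2 - 1]. *)
have [u Xu] : exists u, (X = 1 + u * (p ^ 2 - 1))%N.
  have /dvdnP[u Xu] : (p ^ 2 - 1 %| X - 1)%N.
    by rewrite /X expnM dvdn_subX1.
  by exists u; rewrite -Xu subnKC // expn_gt0 ltnW.
have [v Yv] : exists v, (Y = p * (1 + v * (p ^ 2 - 1)))%N.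
  have /dvdnP[v Yv] : (p ^ 2 - 1 %| p ^ (2 * (2 * n - 1)) - 1)%N.
    by rewrite expnM dvdn_subX1.
  exists v; rewrite -Yv subnKC ?expn_gt0 1?ltnW // -expnS.
  by congr (_ ^ _)%N; lia.
have leX : (p ^ 2 <= X * X)%N by rewrite -XX leq_exp2l //; lia.
rewrite XX => sum1 sum2 A0_gt0 /dvdnP[w A0w].
have pp : (p ^ 2 = p * p)%N by [].
rewrite pp in Xu Yv leX sum2 A0w.
clearbody X Y; clear XX pp.
pose P := p%:Z; pose d : int := Y%:Z - A1%:Z.
have P_ge2 : (2%:Z <= P)%R by rewrite /P; lia.
have A1d : A1%:Z = Y%:Z - d by rewrite /d; ring.
have pB1 : (p - 1)%N%:Z = P - 1 by rewrite -subzn // ltnW.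
have ppB1 : (p * p - 1)%N%:Z = P * P - 1.
  by rewrite -subzn ?PoszM // muln_gt0 ltnW.
have {}YX : P * Y%:Z = X%:Z * X%:Z by rewrite -!PoszM YX.
have {}Xu : X%:Z = 1 + u%:Z * (P * P - 1) by rewrite Xu PoszD PoszM ppB1.
have {}Yv : Y%:Z = P * (1 + v%:Z * (P * P - 1)).
  by rewrite Yv PoszM PoszD PoszM ppB1.
have {}A0w : A0%:Z = 1 + w%:Z * (P * P - 1).
  by rewrite -ppB1 -PoszM -A0w -subzn // subrKC.
have A0d : A0%:Z = Y%:Z + (P - 1) * d.
  have -> : A0%:Z = P * Y%:Z - (P - 1) * A1%:Z.
    by rewrite YX -pB1 -!PoszM -sum1 PoszD addrK.
  by rewrite A1d; ring.
have {}sum2 : A0%:Z * A0%:Z + (P - 1) * (A1%:Z * A1%:Z) =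
    P * P * (P * Y%:Z) + (P * Y%:Z - P * P) * Y%:Z.
  by move/(congr1 Posz): sum2; rewrite YX !PoszD !PoszM pB1 -subzn ?PoszM.
have : (d - X%:Z) * (d + X%:Z) == 0.
  have P1 : P * (P - 1) != 0 by rewrite mulf_neq0 //; lia.
  rewrite -(inj_eq (mulfI P1)) mulr0 -subr_sqr [X%:Z ^+ 2]expr2 -YX.
  rewrite A0d A1d in sum2; move/eqP: sum2; rewrite -subr_eq0 => /eqP sum2.
  by apply/eqP; rewrite -[RHS]sum2; ring.
rewrite mulf_eq0 => /orP[]; rewrite ?subr_eq0 ?addr_eq0 => /eqP dX.
  (* If [d = X], the congruence for [A0] says that [P * P - 1] divides [2 * (P - 1)], so that
     [P + 1] divides 2; this is impossible for [P >= 2]. *)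
  have : (P - 1) * (2 - (w%:Z - P * v%:Z - (P - 1) * u%:Z) * (P + 1)) = 0.
    rewrite A0d dX Xu Yv in A0w; move/eqP: A0w; rewrite -subr_eq0 => /eqP A0w.
    by rewrite -[RHS]A0w; ring.
  move/eqP; rewrite mulf_eq0 => /orP[/eqP|/eqP]; first by lia.
  move: (_ - _ - _ : int) => k; clearbody P; clear - P_ge2 => kP.
  have [k0|k1] : (k <= 0)%R \/ (1 <= k)%R by lia.
    by have : (k * (P + 1) <= 0)%R; nia.
  by have : ((P + 1) <= k * (P + 1))%R; nia.
split; last by lia.
by apply/eqP; rewrite -eqz_nat PoszD PoszM pB1 A0d dX mulrN subrK.
Qed.

(** * The absolute trace *)

Section TraceForm.

Variables (F : finFieldType) (p e : nat).
Hypotheses (p_pr : prime p) (e_gt0 : (0 < e)%N) (cardF : #|F| = (p ^ e)%N).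

Definition Fp : {set F} := [set s | in_Fp p s].

Local Notation Tr := (@Tr F p e).

Let pcharF : p \in [pchar F]. Proof. exact: card_finPcharP cardF p_pr. Qed.

Lemma FpP s : reflect (s ^+ p = s) (s \in Fp).
Proof. by rewrite inE; apply: eqP. Qed.

Lemma frobD k (x y : F) : (x + y) ^+ (p ^ k) = x ^+ (p ^ k) + y ^+ (p ^ k).
Proof.
apply: exprDn_pchar.
by rewrite (eq_pnat _ (pcharf_eq pcharF)) pnatX pnat_id.
Qed.

Lemma frob1D (x y : F) : (x + y) ^+ p = x ^+ p + y ^+ p.
Proof. exact: (frobD 1). Qed.

Lemma frob0 k : (0 : F) ^+ (p ^ k) = 0.
Proof. by rewrite expr0n gtn_eqF ?expn_gt0 ?prime_gt0. Qed.

Lemma frobN k (x : F) : (- x) ^+ (p ^ k) = - x ^+ (p ^ k).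
Proof. by apply/eqP; rewrite -addr_eq0 addrC -frobD subrr frob0. Qed.

Lemma frobK (x : F) : x ^+ (p ^ e) = x.
Proof. by rewrite -cardF expf_card. Qed.

Lemma frob_inj k : injective (fun x : F => x ^+ (p ^ k)).
Proof.
move=> x y /eqP; rewrite -subr_eq0 -frobN -frobD expf_eq0 subr_eq0.
by case/andP=> _ /eqP.
Qed.

Lemma Fp_frob k s : s \in Fp -> s ^+ (p ^ k) = s.
Proof. by move/FpP=> sp; elim: k => // k IH; rewrite expnS exprM sp. Qed.

Lemma Fp0 : 0 \in Fp. Proof. by apply/FpP; rewrite -[p]expn1 frob0. Qed.
Lemma Fp1 : 1 \in Fp. Proof. by apply/FpP; rewrite expr1n. Qed.

Lemma FpD s t : s \in Fp -> t \in Fp -> s + t \in Fp.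
Proof. by move=> /FpP sp /FpP tp; apply/FpP; rewrite frob1D sp tp. Qed.

Lemma FpN s : s \in Fp -> - s \in Fp.
Proof. by move=> /FpP sp; apply/FpP; rewrite -[p]expn1 frobN expn1 sp. Qed.

Lemma FpNE s : (- s \in Fp) = (s \in Fp).
Proof. by apply/idP/idP => /FpN; rewrite ?opprK. Qed.

Lemma FpB s t : s \in Fp -> t \in Fp -> s - t \in Fp.
Proof. by move=> sp /FpN; apply: FpD. Qed.

Lemma FpM s t : s \in Fp -> t \in Fp -> s * t \in Fp.
Proof. by move=> /FpP sp /FpP tp; apply/FpP; rewrite exprMn sp tp. Qed.

Lemma FpV s : s \in Fp -> s^-1 \in Fp.
Proof. by move=> /FpP sp; apply/FpP; rewrite exprVn sp. Qed.

Lemma FpX s k : s \in Fp -> s ^+ k \in Fp.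
Proof. by move=> sp; elim: k => [|k IH]; rewrite ?Fp1 // exprS FpM. Qed.

Lemma Fp_nat k : k%:R \in Fp.
Proof. by elim: k => [|k IH]; rewrite ?Fp0 // -natr1 FpD ?Fp1. Qed.

Lemma pred_exp_dvd k : (k %| e)%N -> ((p ^ k).-1 %| #|F|.-1)%N.
Proof.
case/dvdnP=> l el; rewrite cardF el mulnC expnM -subn1 -(subn1 (_ ^ l)).
exact: dvdn_subX1.
Qed.

Lemma card_Fp : #|Fp| = p.
Proof.
have p1 := prednK (prime_gt0 p_pr).
rewrite -[RHS]p1 -(@card_expr_fixed F p.-1) ?p1 //.
by have := @pred_exp_dvd 1 (dvd1n e); rewrite expn1.
Qed.

Lemma TrD x y : Tr (x + y) = Tr x + Tr y.
Proof. by rewrite /Defs.Tr -big_split; apply: eq_bigr => i _; rewrite frobD. Qed.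

Lemma Tr0 : Tr 0 = 0.
Proof. by apply: big1 => i _; rewrite frob0. Qed.

Lemma TrN x : Tr (- x) = - Tr x.
Proof. by apply/eqP; rewrite -addr_eq0 addrC -TrD subrr Tr0. Qed.

Lemma TrZ c x : c \in Fp -> Tr (c * x) = c * Tr x.
Proof.
move=> cp; rewrite /Defs.Tr mulr_sumr; apply: eq_bigr => i _.
by rewrite exprMn Fp_frob.
Qed.

(** Frobenius permutes the summands of the trace cyclically, since [x ^+ (p ^ e) = x]. *)
Lemma Tr_frob x : Tr (x ^+ p) = Tr x.
Proof.
rewrite /Defs.Tr; case: e e_gt0 frobK => // n _ xq.
rewrite big_ord_recr big_ord_recl /= expn0 expr1 addrC; congr (_ + _).
  by rewrite -exprM -expnS xq.
by apply: eq_bigr => i _; rewrite -exprM -expnS.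
Qed.

Lemma Tr_exprp x : Tr x ^+ p = Tr x.
Proof.
rewrite -[RHS]Tr_frob /Defs.Tr.
rewrite (big_morph (fun x => x ^+ p) frob1D (etrans (congr1 _ (esym (expn1 p))) (frob0 1))).
by apply: eq_bigr => i _; rewrite exprAC.
Qed.

Lemma Tr_Fp x : Tr x \in Fp. Proof. exact/FpP/Tr_exprp. Qed.

Lemma Tr_of_Fp c : c \in Fp -> Tr c = c *+ e.
Proof.
move=> cp; rewrite /Defs.Tr (eq_bigr (fun=> c)) ?sumr_const ?card_ord //.
by move=> i _; rewrite Fp_frob.
Qed.

(** The trace is a nonzero polynomial of degree [p ^ (e - 1)], too small to vanish on all [p ^ e]
    elements of the field. *)
Lemma Tr_neq0 : exists x, Tr x != 0.
Proof.
apply/existsP; rewrite -[[exists _, _]]negbK negb_exists.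
apply/negP => /forallP Tr00; pose P : {poly F} := \sum_(i < e) 'X^(p ^ i).
have e1 : (e.-1 < e)%N by rewrite prednK.
have P0 : P != 0.
  apply: contraTneq isT => /(congr1 (fun q : {poly F} => q`_(p ^ e.-1))).
  rewrite coef0 coef_sum (bigD1 (Ordinal e1)) //= coefXn eqxx big1 ?addr0.
    by move/eqP; rewrite oner_eq0.
  move=> i /eqP ii; rewrite coefXn eqn_exp2l ?prime_gt1 // eq_sym.
  by case: eqP => // ie; case: ii; apply: val_inj.
have := @max_poly_roots _ P (enum F) P0 _ (enum_uniq _).
rewrite -cardE cardF => lt_size.
have : (p ^ e < size P)%N.
  apply: lt_size; apply/allP => x _; rewrite /root horner_sum.
  rewrite (eq_bigr (fun i : 'I_e => x ^+ (p ^ i))) ?(negbNE (Tr00 x)) //.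
  by move=> i _; rewrite hornerXn.
rewrite ltnNge => /negP; apply; apply: leq_trans (size_sum _ _ _) _.
apply/bigmax_leqP => i _; rewrite size_polyXn ltn_exp2l ?prime_gt1 //.
Qed.

Lemma Tr_nondeg a : a != 0 -> exists x, Tr (a * x) != 0.
Proof. by move=> a0; have [x Trx] := Tr_neq0; exists (a^-1 * x); rewrite mulVKf. Qed.

(** On the [Fp]-subspace [V], the vector [x0] satisfies [Tr (a * x0) = 1]; translations by its
    multiples identify the [p] fibers of [Tr (a * x)] with one another. The lemma serves for the
    whole field and for the radical. *)
Lemma card_Tr_fiber (V : {set F}) (a x1 s : F) :
  {in V &, forall x y, x + y \in V} -> {in Fp & V, forall c x, c * x \in V} ->
  x1 \in V -> Tr (a * x1) != 0 -> s \in Fp ->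
  (#|[set x in V | Tr (a * x)%R == s]| * p = #|V|)%N.
Proof.
move=> VD VZ Vx1 Tx1 sp; pose x0 := (Tr (a * x1))^-1 * x1.
have Vx0 c : c \in Fp -> c * x0 \in V by move=> cp; rewrite !VZ // FpV ?Tr_Fp.
have Tx0 c : c \in Fp -> Tr (a * (c * x0)) = c.
  move=> cp; have -> : a * (c * x0) = c / Tr (a * x1) * (a * x1) by rewrite /x0; ring.
  by rewrite TrZ ?divfK ?FpM ?FpV ?Tr_Fp.
rewrite (@card_sum_fibers _ _ (fun x => Tr (a * x)) V Fp) => [|x _]; last exact: Tr_Fp.
rewrite -[X in (_ * X)%N]card_Fp mulnC -sum_nat_const; apply: eq_bigr => t tp.
apply: (@card_set_bij _ (+%R ((t - s) * x0)) (+%R (- ((t - s) * x0)))).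
- by move=> x; rewrite addKr.
- by move=> x; rewrite addNKr.
move=> x; rewrite mulrDr TrD Tx0 ?FpB //; congr (_ && _); last first.
  by rewrite -(subr_eq0 _ t) -(subr_eq0 _ s); congr (_ == 0); ring.
apply/idP/idP => Vx; first by rewrite VD ?Vx0 ?FpB.
by rewrite -[x](addKr ((t - s) * x0)) VD // -mulNr Vx0 ?FpN ?FpB.
Qed.

Lemma card_Tr_eq (a s : F) : a != 0 -> s \in Fp ->
  (#|[set x | Tr (a * x)%R == s]| * p = p ^ e)%N.
Proof.
case/Tr_nondeg => x Trx sp.
rewrite -cardF -cardsT -(@card_Tr_fiber setT a x s) //; try by move=> *; rewrite inE.
by congr (_ * _)%N; apply: eq_card => y; rewrite !inE.
Qed.

(** * The quadratic form Tr(x^(p+1)) *)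

Hypotheses (p_odd : odd p) (e4 : (4 %| e)%N).

Definition qform (x : F) : F := Tr (x ^+ p.+1).
Definition polar (x y : F) : F := Tr (x ^+ p * y + x * y ^+ p).
(** The second term is the inverse Frobenius of [y]. This map represents the polar form through the
    trace: [polar x y = Tr (polar_dual y * x)]. *)
Definition polar_dual (y : F) : F := y ^+ p + y ^+ (p ^ e.-1).
(** The kernel of [polar_dual], whose equation takes this form once it is raised to the power
    [p]. *)
Definition radical : {set F} := [set y | y ^+ (p ^ 2) == - y].

Lemma two_neq0 : (2 : F) != 0.
Proof.
rewrite -(dvdn_pcharf pcharF) gtnNdvd // ltn_neqAle prime_gt1 // andbT.
by apply: contraTneq p_odd => <-.
Qed.

Lemma qform_Fp x : qform x \in Fp. Proof. exact: Tr_Fp. Qed.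
Lemma polar_Fp x y : polar x y \in Fp. Proof. exact: Tr_Fp. Qed.

Lemma qformD x y : qform (x + y) = qform x + qform y + polar x y.
Proof. by rewrite /qform /polar -!TrD !exprS frob1D; congr Defs.Tr; ring. Qed.

Lemma qformZ c x : c \in Fp -> qform (c * x) = c ^+ 2 * qform x.
Proof.
move=> cp; rewrite /qform -TrZ ?FpX // exprMn exprS (FpP _ cp) -expr2 //.
Qed.

Lemma qform0 : qform 0 = 0. Proof. by rewrite /qform expr0n Tr0. Qed.

Lemma polarC x y : polar x y = polar y x.
Proof. by rewrite /polar; congr Defs.Tr; ring. Qed.

Lemma polarZr c x y : c \in Fp -> polar x (c * y) = c * polar x y.
Proof.
move=> cp; rewrite /polar -TrZ // exprMn (FpP _ cp); congr Defs.Tr; ring.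
Qed.

Lemma polarZl c x y : c \in Fp -> polar (c * x) y = c * polar x y.
Proof. by move=> cp; rewrite polarC polarZr // polarC. Qed.

Lemma polarxx x : polar x x = 2 * qform x.
Proof.
rewrite /polar /qform -TrZ ?Fp_nat // exprS; congr Defs.Tr; ring.
Qed.

Lemma frob_pred (y : F) : (y ^+ (p ^ e.-1)) ^+ p = y.
Proof. by rewrite -exprM -expnSr prednK // frobK. Qed.

Lemma polarE x y : polar x y = Tr (polar_dual y * x).
Proof.
rewrite /polar /polar_dual mulrDl !TrD [RHS]addrC [x * _]mulrC; congr (_ + _).
by rewrite -[RHS]Tr_frob exprMn frob_pred mulrC.
Qed.

Lemma polar_dualD x y : polar_dual (x + y) = polar_dual x + polar_dual y.
Proof. by rewrite /polar_dual frob1D frobD; ring. Qed.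

(** * The radical of the polar form and its order *)

Lemma polar_dual_eq0 y : (polar_dual y == 0) = (y \in radical).
Proof.
rewrite inE -addr_eq0 -(inj_eq (@frob_inj 1)) frob0 expn1 frob1D frob_pred.
by rewrite -exprM.
Qed.

Lemma polar_radical x r : r \in radical -> polar x r = 0.
Proof. by rewrite -polar_dual_eq0 polarE => /eqP->; rewrite mul0r Tr0. Qed.

Lemma qform_radical r : r \in radical -> qform r = 0.
Proof.
move=> Rr; apply: (mulfI two_neq0).
by rewrite -polarxx polar_radical // mulr0.
Qed.

Lemma qform_addr x r : r \in radical -> qform (x + r) = qform x.
Proof. by move=> Rr; rewrite qformD (qform_radical Rr) polar_radical // !addr0. Qed.

Lemma radicalD : {in radical &, forall x y, x + y \in radical}.
Proof.
by move=> x y; rewrite -!polar_dual_eq0 polar_dualD => /eqP-> /eqP->; rewrite addr0.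
Qed.

Lemma radicalZ : {in Fp & radical, forall c x, c * x \in radical}.
Proof. by move=> c x cp; rewrite !inE exprMn (Fp_frob _ cp) => /eqP->; rewrite mulrN. Qed.

Lemma radical0 : 0 \in radical.
Proof. by rewrite inE frob0 oppr0. Qed.

Let e2 : (2 %| e)%N. Proof. exact: dvdn_trans e4. Qed.

(** As 4 divides [e] and [p ^ 2 + 1] is even, [2 * (p ^ 2 - 1)] divides [p ^ e - 1]. A primitive
    root [z] of that order has [z ^+ (p ^ 2) = - z], so division by [z] carries the radical onto the
    subfield of order [p ^ 2]. *)
Lemma card_radical : #|radical| = (p ^ 2)%N.
Proof.
have p2_gt0 : (0 < p ^ 2)%N by rewrite expn_gt0 prime_gt0.
have [|z pz] := @finField_prim_root F (2 * (p ^ 2).-1).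
  apply: dvdn_trans (pred_exp_dvd e4).
  have -> : ((p ^ 4).-1 = (p ^ 2 + 1) * (p ^ 2).-1)%N.
    rewrite -subn1 (expnM p 2 2) -[1%N in LHS](exp1n 2) subn_sqr subn1; lia.
  by rewrite dvdn_mul // dvdn2 oddD oddX p_odd.
have z0 := prim_root_neq0 pz.
have zN1 : z ^+ (p ^ 2).-1 = -1.
  have : (z ^+ (p ^ 2).-1) ^+ 2 = 1 by rewrite -exprM mulnC (prim_expr_order pz).
  move/eqP; rewrite sqrf_eq1 => /orP[|/eqP//].
  rewrite -(prim_order_dvd pz) => /dvdn_leq.
  have : (1 < p ^ 2)%N by rewrite -[1%N](expn0 p) ltn_exp2l // prime_gt1.
  lia.
rewrite -[RHS](prednK p2_gt0) -(@card_expr_fixed F) ?pred_exp_dvd // prednK //.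
rewrite /radical; apply: (@card_set_bij _ (fun x => x / z) (fun x => x * z)).
- by move=> x; rewrite divfK.
- by move=> x; rewrite mulfK.
have zp2 : z ^+ (p ^ 2) = - z by rewrite -(prednK p2_gt0) exprS zN1 mulrN1.
move=> x; rewrite expr_div_n zp2 invrN mulrN.
by rewrite -mulNr (inj_eq (mulIf _)) ?invr_eq0 // eqr_oppLR.
Qed.

(** * Sizes of the level sets of the quadratic form *)

Let Fp2_exp (l : F) : l ^+ (p ^ 2).-1 = 1 -> l ^+ p.+1 \in Fp.
Proof.
move=> l1; apply/FpP; rewrite -exprM.
have -> : (p.+1 * p = p.+1 + (p ^ 2).-1)%N.
  by have := prime_gt0 p_pr; case: (p) => // n _; rewrite expnS expn1; lia.
by rewrite exprD l1 mulr1.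
Qed.

(** For [l] in the subfield of order [p ^ 2], [l ^+ p.+1] is the norm of [l] to the prime field and
    leaves the trace as a scalar. *)
Let qform_scale (l x : F) : l ^+ (p ^ 2).-1 = 1 -> qform (l * x) = l ^+ p.+1 * qform x.
Proof. by move=> l1; rewrite /qform exprMn TrZ // Fp2_exp. Qed.

Let p2E : ((p ^ 2).-1 = p.+1 * p.-1)%N.
Proof. by have := prime_gt0 p_pr; case: (p) => // n _; rewrite expnS expn1; lia. Qed.

(** The norm is onto: if [z] generates the units of the subfield of order [p ^ 2], then [z ^+ p.+1]
    generates those of [Fp]. Hence [t] is the norm of some [l], and multiplication by [l] maps the
    level of 1 onto the level of [t]. *)
Lemma card_qform_scale t : t \in Fp -> t != 0 ->
  #|[set x | qform x == t]| = #|[set x | qform x == 1%R]|.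
Proof.
move=> tp t0; have [z pz] := finField_prim_root (pred_exp_dvd e2).
have pz1 : p.-1.-primitive_root (z ^+ p.+1).
  have p1_gt0 : (0 < p.-1)%N by rewrite -ltnS prednK ?prime_gt1 ?prime_gt0.
  have := @dvdn_prim_root _ _ _ pz p.-1.
  by rewrite p2E mulnK // dvdn_mull // => /(_ isT).
have [i ti] : {i : 'I_p.-1 | t = (z ^+ p.+1) ^+ i}.
  apply: (prim_rootP pz1); apply: (mulfI t0).
  by rewrite mulr1 -exprS prednK ?prime_gt0 //; apply/FpP.
pose l := z ^+ i; have l1 : l ^+ (p ^ 2).-1 = 1.
  by rewrite exprAC (prim_expr_order pz) expr1n.
have lt : l ^+ p.+1 = t by rewrite exprAC.
have l0 : l != 0 by apply: contraNneq t0 => l0; rewrite -lt l0 expr0n.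
apply/esym/(@card_set_bij _ ( *%R l) ( *%R l^-1)) => x; rewrite ?mulKf ?mulVKf //.
by rewrite qform_scale // lt -{2}[t]mulr1 (inj_eq (mulfI t0)).
Qed.

Lemma sum_Fp_split (f : F -> nat) n : {in Fp, forall t, t != 0 -> f t = n} ->
  (\sum_(t in Fp) f t = f 0%R + (p - 1) * n)%N.
Proof.
move=> fn; rewrite (bigD1 0) ?Fp0 //=; congr addn.
rewrite (eq_bigr (fun=> n)) => [|t /andP[tp t0]]; last exact: fn.
rewrite sum_nat_cond_const; congr muln.
have -> : [set x in Fp | x != 0] = Fp :\ 0 by apply/setP=> x; rewrite !inE andbC.
by rewrite -card_Fp (cardsD1 0 Fp) Fp0 addKn.
Qed.

Lemma card_Fp_sum (f : F -> F) : (forall x, f x \in Fp) ->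
  (p ^ e = \sum_(t in Fp) #|[set x | f x == t]|)%N.
Proof.
move=> fp; rewrite -cardF -cardsT (@card_sum_fibers _ _ f setT Fp) //.
by apply: eq_bigr => t _; apply: eq_card => x; rewrite !inE.
Qed.

Lemma card_polar_eq b s : b \notin radical -> s \in Fp ->
  #|[set y | polar y b == s]| = (p ^ (e - 1))%N.
Proof.
rewrite -polar_dual_eq0 => b0 sp; apply/eqP.
rewrite -(eqn_pmul2r (prime_gt0 p_pr)) -expnSr subn1 prednK //.
rewrite -(card_Tr_eq b0 sp); apply/eqP; congr muln.
by apply: eq_card => y; rewrite !inE polarE.
Qed.

(** The left side counts the pairs with [qform x = qform y]. Put [x = y + v]: the condition becomes
    [polar y v = - qform v], which holds for every [y] when [v] lies in the radical and for
    [p ^ (e - 1)] of them otherwise. *)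
Lemma qform_second_moment :
  (\sum_(t in Fp) #|[set x | qform x == t]| * #|[set x | qform x == t]| =
     p ^ 2 * p ^ e + (p ^ e - p ^ 2) * p ^ (e - 1))%N.
Proof.
transitivity (\sum_(v : F) #|[set y | qform (y + v)%R == qform y]|)%N.
  transitivity (\sum_(y : F) #|[set x | qform x == qform y]|)%N.
    rewrite [RHS](partition_big qform (fun t => t \in Fp)) => [|y _]; last exact: qform_Fp.
    apply: eq_bigr => t _; rewrite -sum_nat_cond_const.
    by apply: eq_bigr => y /= /eqP ->.
  under eq_bigr do rewrite card_set_sum.
  under [RHS]eq_bigr do rewrite card_set_sum.
  rewrite [RHS]exchange_big; apply: eq_bigr => y _ /=.
  by rewrite (reindex_inj (addrI y)).
rewrite (bigID (mem radical)) /=; congr addn.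
  rewrite -card_radical -cardF -sum_nat_const; apply: eq_bigr => v Rv.
  by rewrite -cardsT; apply: eq_card => y; rewrite !inE qform_addr ?eqxx.
have -> : (p ^ e - p ^ 2 = #|~: radical|)%N by rewrite cardsCs setCK cardF card_radical.
rewrite -sum_nat_const; apply: eq_big => [v|v Rv]; first by rewrite !inE.
rewrite -(@card_polar_eq v (- qform v)) ?FpN ?qform_Fp //.
apply: eq_card => y; rewrite !inE qformD -subr_eq0 -[RHS]subr_eq0.
by congr (_ == 0); ring.
Qed.

(** The units of the subfield of order [p ^ 2] act freely on the nonzero zeros of the form. *)
Lemma card_qform0_mod : (p ^ 2 - 1 %| #|[set x | qform x == 0%R]| - 1)%N.
Proof.
have [z pz] := finField_prim_root (pred_exp_dvd e2).
have := @prim_root_dvd_card F _ z ([set x | qform x == 0] :\ 0) pz.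
rewrite !subn1 [#|[set x | _]|](cardsD1 0) !inE qform0 !eqxx /=; apply => // x.
have z1 := prim_expr_order pz.
have z0 := prim_root_neq0 pz.
rewrite !inE mulf_eq0 negb_or qform_scale // z0 => /andP[-> /eqP->].
by rewrite mulr0 eqxx.
Qed.

Lemma card_qform_level :
  (#|[set x | qform x == 0%R]| + (p - 1) * p ^ (e %/ 2) = p ^ (e - 1))%N /\
  {in Fp, forall t, t != 0 ->
    #|[set x | qform x == t]| = (p ^ (e - 1) + p ^ (e %/ 2))%N}.
Proof.
have [n] := dvdnP e4; rewrite mulnC => en.
have -> : (e %/ 2 = 2 * n)%N by lia.
have [||||||H0 H1] := @level_sizes_of_moments p n #|[set x | qform x == 0%R]|
  #|[set x | qform x == 1%R]|.
- exact: prime_gt1.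
- by lia.
- rewrite -en (card_Fp_sum qform_Fp).
  by rewrite (sum_Fp_split (n := #|[set x | qform x == 1%R]|)) // => t;
    apply: card_qform_scale.
- rewrite -en -qform_second_moment.
  rewrite (sum_Fp_split (n := #|[set x | qform x == 1%R]| * #|[set x | qform x == 1%R]|)) //.
  by move=> t tp t0; rewrite !card_qform_scale.
- by apply/card_gt0P; exists 0; rewrite inE qform0.
- exact: card_qform0_mod.
by rewrite -en in H0 H1; split=> // t tp t0; rewrite card_qform_scale.
Qed.

(** Merges the zero and nonzero levels; the deficit of the zero level stands on the left to avoid
    truncated subtraction. *)
Lemma card_qform_eq t : t \in Fp ->
  (#|[set x | qform x == t]| + p * p ^ (e %/ 2) * (t == 0%R) =
     p ^ (e - 1) + p ^ (e %/ 2))%N.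
Proof.
have [H0 H1] := card_qform_level; move=> tp; have p_gt0 := prime_gt0 p_pr.
have [->|t0] := eqVneq t 0; last by rewrite muln0 addn0 H1.
rewrite muln1 -H0 -addnA -mulSnr; congr (_ + _ * _)%N; lia.
Qed.

Lemma card_qform_in (L : {set F}) : L \subset Fp ->
  (#|[set x | qform x \in L]| + p * p ^ (e %/ 2) * (0%R \in L) =
     #|L| * (p ^ (e - 1) + p ^ (e %/ 2)))%N.
Proof.
move=> /subsetP LFp.
have -> : nat_of_bool (0 \in L) = (\sum_(t in L) (t == 0%R))%N.
  case: (boolP (0 \in L)) => L0; last first.
    by rewrite big1 // => t Lt; case: eqP Lt L0 => // -> ->.
  by rewrite (bigD1 0) //= eqxx big1 ?addn0 // => t /andP[_ /negbTE->].
rewrite (@card_sum_fibers _ _ qform _ L) => [|x]; last by rewrite inE.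
rewrite big_distrr -big_split -sum_nat_const; apply: eq_bigr => t Lt.
rewrite -(card_qform_eq (LFp t Lt)); congr addn; apply: eq_card => x; rewrite !inE.
by case: eqP => [->|]; rewrite ?Lt ?andbF.
Qed.

(** * Joint distribution of the form and of a polar pairing *)

Lemma card_Fp_affine (u v u' v' : F) :
  u \in Fp -> v \in Fp -> u' \in Fp -> v' \in Fp ->
  #|[set w in Fp | u + w * v == u' + w * v']| =
    ((v != v') + p * ((u == u') && (v == v')))%N.
Proof.
move=> up vp u'p v'p; have [<-|vv'] := eqVneq v v'.
  rewrite andbT add0n; under eq_finset do rewrite (inj_eq (addIr _)).
  case: (u == u'); rewrite ?muln1 ?muln0.
    by rewrite -[RHS]card_Fp; apply: eq_card => w; rewrite !inE andbT.
  by apply: eq_card0 => w; rewrite !inE andbF.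
have vv'0 : v - v' != 0 by rewrite subr_eq0.
rewrite andbF muln0 addn0 -[RHS](cards1 ((u' - u) / (v - v'))).
apply: eq_card => w.
rewrite !inE -subr_eq0.
have -> : u + w * v - (u' + w * v') = (w - (u' - u) / (v - v')) * (v - v').
  by field.
rewrite mulf_eq0 (negbTE vv'0) orbF subr_eq0 andb_idl // => /eqP->.
by have := FpM (FpB u'p up) (FpV (FpB vp v'p)); rewrite inE.
Qed.

(* Translating by the multiples [w * b] turns the level [t + w s + w ^ 2 Q(b)]
   of [Q] into the line [Q(y) + w B(y, b) = t + w s], so summing over [w] and
   counting the [w] on which a given [y] lies isolates the pairs (t, s). *)
Lemma card_qform_polar b t s : b \notin radical -> t \in Fp -> s \in Fp ->
  (#|[set y | (qform y == t) && (polar y b == s)]| +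
   p ^ (e %/ 2) * #|[set w in Fp | t + w * s + w ^+ 2 * qform b == 0]|%R =
     p ^ (e - 2) + p ^ (e %/ 2))%N.
Proof.
move=> Rb tp sp; pose c w := t + w * s + w ^+ 2 * qform b.
set N := #|_|; set M := #|_|.
have cp w : w \in Fp -> c w \in Fp.
  by move=> wp; rewrite !FpD ?FpM ?FpX ?qform_Fp.
have levels : (\sum_(w in Fp) #|[set x | qform x == c w]| + p * p ^ (e %/ 2) * M =
    p * (p ^ (e - 1) + p ^ (e %/ 2)))%N.
  have -> : (M = \sum_(w in Fp) (c w == 0%R))%N.
    rewrite /M -sum1dep_card big_mkcondr; apply: eq_bigr => w _.
    by rewrite -/(c w); case: eqP.
  rewrite big_distrr -big_split -[X in (_ = X * _)%N]card_Fp -sum_nat_const.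
  by apply: eq_bigr => w wp; apply: card_qform_eq; apply: cp.
(* After the exchange of sums, [y] contributes 1 if [polar y b != s], [p] if it is counted by [N],
   and 0 otherwise. The added [p ^ (e - 1)] is the number of [y] with [polar y b = s]. *)
have lines : (\sum_(w in Fp) #|[set x | qform x == c w]| + p ^ (e - 1) =
    p ^ e + p * N)%N.
  have -> : (\sum_(w in Fp) #|[set x | qform x == c w]| =
      \sum_(y : F) #|[set w in Fp | qform y + w * polar y b == t + w * s]|%R)%N.
    transitivity (\sum_(w in Fp) \sum_(y : F)
        ((qform y + w * polar y b == t + w * s)%R : nat))%N.
      apply: eq_bigr => w wp; rewrite -card_set_sum.
      apply: (@card_set_bij _ (fun x => x - w * b) (fun y => y + w * b)).
      - by move=> x; rewrite subrK.
      - by move=> x; rewrite addrK.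
      move=> x; rewrite -{1}[x](subrK (w * b)) qformD qformZ // polarZr //.
      rewrite -subr_eq0 -[RHS]subr_eq0; congr (_ == 0); rewrite /c; ring.
    rewrite exchange_big; apply: eq_bigr => y _.
    by rewrite -sum1dep_card [RHS]big_mkcondr; apply: eq_bigr => w _; case: eqP.
  under eq_bigr do rewrite card_Fp_affine ?qform_Fp ?polar_Fp //.
  rewrite big_split -big_distrr /= -!card_set_sum -/N addnAC; congr addn.
  rewrite -(card_polar_eq Rb sp) -cardF -cardsT addnC.
  rewrite -(cardsID [set y | polar y b == s] setT).
  by congr addn; apply: eq_card => y; rewrite !inE ?andbT.
have p_gt0 := prime_gt0 p_pr.
have e_ge4 := dvdn_leq e_gt0 e4.
have E1 : (p ^ e = p * p ^ (e - 1))%N by rewrite -expnS; congr expn; lia.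
have E2 : (p ^ (e - 1) = p * p ^ (e - 2))%N by rewrite -expnS; congr expn; lia.
apply/eqP; rewrite -(eqn_pmul2l p_gt0); apply/eqP; lia.
Qed.

(** Sum of [card_qform_polar] over [t] in [L]: each [w] solves the quadratic condition for exactly
    one value of [t], which has to lie in [L]. *)
Lemma card_qform_in_polar (L : {set F}) b s :
  L \subset Fp -> b \notin radical -> s \in Fp ->
  (#|[set y | (qform y \in L) && (polar y b == s)]| +
   p ^ (e %/ 2) * #|[set w in Fp | - (w * s + w ^+ 2 * qform b) \in L]|%R =
     #|L| * (p ^ (e - 2) + p ^ (e %/ 2)))%N.
Proof.
move=> /subsetP LFp Rb sp.
rewrite (@card_sum_fibers _ _ qform _ L) => [|x]; last by rewrite inE => /andP[].
rewrite (@card_sum_fibers _ _ (fun w => - (w * s + w ^+ 2 * qform b)) _ L); last first.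
  by move=> w; rewrite inE => /andP[].
rewrite big_distrr -big_split -sum_nat_const; apply: eq_bigr => t Lt.
rewrite -(card_qform_polar Rb (LFp t Lt) sp); congr (_ + _ * _)%N.
  apply: eq_card => x; rewrite !inE.
  by case: (qform x =P t) => [->|_]; rewrite ?Lt ?andbF ?andbT.
apply: eq_card => w; rewrite !inE -andbA; congr andb.
rewrite -addrA addr_eq0 [t == _]eq_sym andb_idl // => /eqP->; exact: Lt.
Qed.

(** * The image of [polar_dual] as the orthogonal of the radical *)

Lemma polar_dualB x y : polar_dual (x - y) = polar_dual x - polar_dual y.
Proof. by apply/eqP; rewrite eq_sym subr_eq -polar_dualD subrK. Qed.

Lemma polar_dual_eq x y : (polar_dual x == polar_dual y) = (x - y \in radical).
Proof. by rewrite -polar_dual_eq0 polar_dualB subr_eq0. Qed.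

Lemma card_polar_dual_preim (X : {set F}) :
  {in X & radical, forall x r, x + r \in X} ->
  #|X| = (#|polar_dual @: X| * p ^ 2)%N.
Proof.
move=> XR; apply: card_uniform_fibers => x Xx; rewrite -card_radical.
rewrite -[in RHS](card_imset _ (addrI x)); apply: eq_card => y.
rewrite inE polar_dual_eq; apply/andP/imsetP => [[_ Ryx] | [r Rr ->]].
  by exists (y - x); rewrite // addrC subrK.
by rewrite XR // addrC addKr.
Qed.

(** By contraposition: the image of [polar_dual] lies in the orthogonal [perp] of the radical and
    has [p ^ (e - 2)] elements, so it suffices that [perp] is no larger. This follows by counting
    the pairs [(c, r)] with [Tr (c * r) = 0] in two ways. *)
Lemma radical_separates a : a \notin polar_dual @: setT ->
  exists2 r, r \in radical & Tr (a * r) != 0.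
Proof.
move=> im_a; apply/exists_inP; apply: contraNT im_a; rewrite negb_exists.
pose perp := [set a : F | [forall r, ~~ ((r \in radical) && (Tr (a * r) != 0))]].
have perpP c : reflect {in radical, forall r, Tr (c * r) = 0} (c \in perp).
  rewrite inE; apply: (iffP forallP) => [cr r Rr | cr r].
    by have := cr r; rewrite Rr => /negPn/eqP.
  by apply/negP => /andP[Rr]; rewrite cr ?eqxx.
move=> a_perp; have {a_perp} : a \in perp by rewrite inE.
suff /eqP <- : polar_dual @: setT == perp by [].
have p_gt1 := prime_gt1 p_pr; have p_gt0 := prime_gt0 p_pr.
have e_ge4 := dvdn_leq e_gt0 e4.
have E1 : (p ^ e = p * p ^ (e - 1))%N by rewrite -expnS; congr expn; lia.
have E2 : (p ^ (e - 1) = p * p ^ (e - 2))%N by rewrite -expnS; congr expn; lia.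
rewrite eqEcard; apply/andP; split.
  apply/subsetP => _ /imsetP[b _ ->]; apply/perpP => r Rr.
  by rewrite -polarE polarC polar_radical.
have im_card : #|polar_dual @: setT| = (p ^ (e - 2))%N.
  apply/eqP; rewrite -(@eqn_pmul2r (p ^ 2)) ?expn_gt0 ?p_gt0 //.
  rewrite -card_polar_dual_preim ?cardsT ?cardF => [|? ? _ _]; last by rewrite inE.
  by rewrite -expnD subnK // ltnW // ltnW.
have pairs : (\sum_(c : F) #|[set r in radical | Tr (c * r)%R == 0%R]| =
    \sum_(r in radical) #|[set c | Tr (r * c)%R == 0%R]|)%N.
  under [RHS]eq_bigr do rewrite card_set_sum.
  rewrite exchange_big; apply: eq_bigr => c _ /=.
  rewrite -sum1dep_card big_mkcondr; apply: eq_bigr => r _.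
  by rewrite mulrC; case: eqP.
have by_c : (\sum_(c : F) #|[set r in radical | Tr (c * r)%R == 0%R]| =
    #|perp| * p ^ 2 + #|~: perp| * p)%N.
  rewrite (bigID (fun c => c \in perp)) /=; congr addn.
    rewrite -sum_nat_const; apply: eq_bigr => c /perpP cr; rewrite -card_radical.
    by apply: eq_card => r; rewrite inE andb_idr // => Rr; rewrite cr.
  rewrite -sum_nat_const; apply: eq_big => [c | c cr]; first by rewrite !inE.
  have /exists_inP[r Rr Tcr] : [exists r in radical, Tr (c * r) != 0].
    by apply: contraNT cr; rewrite negb_exists inE.
  apply/eqP; rewrite -(eqn_pmul2r p_gt0).
  by rewrite (card_Tr_fiber radicalD radicalZ Rr Tcr) ?Fp0 // card_radical.
have by_r : (\sum_(r in radical) #|[set c | Tr (r * c)%R == 0%R]| =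
    p ^ e + #|radical :\ 0%R| * p ^ (e - 1))%N.
  rewrite (bigD1 0) ?radical0 //=; congr addn.
    by rewrite -cardF -cardsT; apply: eq_card => c; rewrite !inE mul0r Tr0 eqxx.
  rewrite -sum_nat_const; apply: eq_big => [r | r /andP[_ r0]].
    by rewrite !inE andbC.
  apply/eqP; rewrite -(eqn_pmul2r p_gt0) -expnSr.
  by rewrite card_Tr_eq ?Fp0 // subn1 prednK.
move: pairs; rewrite by_c by_r im_card.
have := cardsC perp; have := cardsD1 0 radical.
rewrite card_radical radical0 cardF.
(* The factor [p * (p - 1)] is the coefficient of [#|perp|] once [#|~: perp|] is eliminated from the
   two counts. *)
rewrite -(leq_pmul2r (m := p * (p - 1))) ?muln_gt0 ?subn_gt0 ?p_gt0 //.
rewrite E1 E2 -mulnn; move: #|_ :\ _| #|perp| #|~: _| (p ^ (e - 2))%N.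
clear -p_gt1 => x y z Z.
have [q ->] : exists q, p = q.+1 by exists p.-1; rewrite prednK // ltnW.
by nia.
Qed.

(** * Squares and non-squares of the prime field *)

Definition class_set (i : 'I_2) : {set F} := [set t | Cclass p i t].

Let C0P (t : F) : reflect (exists s, [/\ s \in Fp, s != 0 & t = s ^+ 2]) (C0 p t).
Proof.
apply: (iffP existsP) => [[s /and3P[sp s0 /eqP ->]] | [s [sp s0 ->]]]; exists s.
  by rewrite inE.
by move: sp; rewrite inE s0 eqxx => ->.
Qed.

Let C0_Fp (t : F) : C0 p t -> t \in Fp.
Proof. by case/C0P => s [sp _ ->]; rewrite FpX. Qed.

Let C0_neq0 (t : F) : C0 p t -> t != 0.
Proof. by case/C0P => s [_ s0 ->]; rewrite expf_neq0. Qed.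

Let C0_sq (c t : F) : c \in Fp -> c != 0 -> C0 p (c ^+ 2 * t) = C0 p t.
Proof.
move=> cp c0; apply/C0P/C0P => [[s [sp s0 ct]] | [s [sp s0 ->]]].
  exists (s / c); split; first by rewrite FpM ?FpV.
    by rewrite mulf_neq0 ?invr_eq0.
  by rewrite expr_div_n -ct mulrC mulKf ?expf_neq0.
by exists (c * s); rewrite FpM // mulf_neq0 // exprMn.
Qed.

Lemma class_set_sub i : class_set i \subset Fp.
Proof.
apply/subsetP => t; rewrite inE /Cclass; case: ifP => _; first exact: C0_Fp.
by case/and3P; rewrite inE.
Qed.

Lemma class_set0 i : 0 \notin class_set i.
Proof.
rewrite inE /Cclass; case: ifP => _; last by rewrite /C1 eqxx andbF.
by apply/negP => /C0_neq0; rewrite eqxx.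
Qed.

Lemma class_set_sq i (c t : F) : c \in Fp -> c != 0 ->
  (c ^+ 2 * t \in class_set i) = (t \in class_set i).
Proof.
move=> cp c0; rewrite !inE /Cclass; case: ifP => _; first exact: C0_sq.
rewrite /C1 C0_sq // mulf_eq0 expf_eq0 (negbTE c0) andbF; congr andb.
have FpE s : in_Fp p s = (s \in Fp) by rewrite inE.
rewrite !FpE; apply/idP/idP => [|tp]; last by rewrite FpM ?FpX.
by move/(FpM (FpV (FpX 2 cp))); rewrite mulKf ?expf_neq0.
Qed.

(** Squaring is two-to-one on the nonzero elements of [Fp], and the non-squares are the complement
    of its image. *)
Lemma card_class_set i : #|class_set i| = ((p - 1) %/ 2)%N.
Proof.
have p_gt0 := prime_gt0 p_pr.
have cFp : #|Fp :\ 0| = (p - 1)%N by rewrite -card_Fp (cardsD1 0 Fp) Fp0 addKn.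
have cC0 : #|[set t : F | C0 p t]| = ((p - 1) %/ 2)%N.
  rewrite -cFp (@card_uniform_fibers _ _ (fun s : F => s ^+ 2) (Fp :\ 0) 2%N) => [|s].
    rewrite mulnK //; apply: eq_card => t; rewrite inE.
    apply/C0P/imsetP => [[s [sp s0 ->]] | [s]]; first by exists s; rewrite ?in_setD1 ?s0.
    by rewrite in_setD1 => /andP[s0 sp] ->; exists s.
  rewrite in_setD1 => /andP[s0 sp].
  have sN : s != - s.
    by rewrite -subr_eq0 opprK -mulr2n -mulr_natl mulf_neq0 ?two_neq0.
  transitivity #|[set s; - s]|; last by rewrite cards2 sN.
  apply: eq_card => u; rewrite !(inE, in_setD1) eqf_sqr andb_idl //.
  have FpE v : in_Fp p v = (v \in Fp) by rewrite inE.
  by case/orP => /eqP->; rewrite ?oppr_eq0 s0 FpE ?FpNE.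
case: i => -[|[|//]] i2; rewrite /class_set /Cclass //=.
have -> : [set t : F | C1 p t] = (Fp :\ 0) :\: [set t : F | C0 p t].
  by apply/setP => t; rewrite !inE /C1; case: (C0 p t); rewrite ?andbF ?andbT //= andbC.
rewrite cardsD (setIidPr _) ?cC0 ?cFp; last first.
  by apply/subsetP => t; rewrite in_setD1 inE => Ct; rewrite C0_neq0 ?C0_Fp.
move: p_odd p_gt0; clear; lia.
Qed.

(** * Weights and their frequencies *)

Hypothesis p_dvd_e : (p %| e)%N.

Lemma polar1 x : polar x 1 = 2 * Tr x.
Proof. by rewrite /polar expr1n !mulr1 TrD Tr_frob -mulr2n mulr_natl. Qed.

Lemma qform1 : qform 1 = 0.
Proof.
rewrite /qform expr1n Tr_of_Fp ?Fp1 //; apply/eqP.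
by rewrite -(dvdn_pcharf pcharF).
Qed.

(** Allows [b = 1] in [card_qform_in_polar]; as [polar y 1 = 2 * Tr y], this counts by [qform y] and
    [Tr y]. *)
Lemma one_notin_radical : 1 \notin radical.
Proof. by rewrite inE expr1n eq_sym -subr_eq0 -opprD oppr_eq0 two_neq0. Qed.

Lemma Tr_radical r : r \in radical -> Tr r = 0.
Proof.
move=> Rr; apply: (mulfI two_neq0).
by rewrite -polar1 polarC polar_radical // mulr0.
Qed.

Let half_Fp : 2^-1 \in Fp. Proof. by rewrite FpV // Fp_nat. Qed.

(* Completing the square; the constant term is a multiple of [Tr 1 = e = 0]. *)
Lemma qform_shift x : Tr (x ^+ p.+1 - x) = qform (x - 2^-1).
Proof.
rewrite TrD TrN qformD -[- 2^-1]mulr1 qformZ ?polarZr ?FpN // qform1 polar1.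
by rewrite mulr0 addr0 mulNr mulKf // two_neq0.
Qed.

(** [K] stands for either quadratic class. Its size, the absence of 0 and the invariance under
    nonzero squares let one argument treat both. *)
Variable K : {set F}.
Hypotheses (KFp : K \subset Fp) (K0 : 0 \notin K) (cardK : #|K| = ((p - 1) %/ 2)%N).
Hypothesis Ksq : forall c t, c \in Fp -> c != 0 -> (c ^+ 2 * t \in K) = (t \in K).

(** For nonzero [u] and [w] the expression is [w ^+ 2 * (u / w - v)], so only [z = u / w - v] has to
    be tested, and [z] takes every value of [Fp] except [- v]. *)
Lemma card_Fp_quadratic (u v : F) : u \in Fp -> v \in Fp ->
  #|[set w in Fp | w * u - w ^+ 2 * v \in K]| =
  if u == 0 then ((p - 1) * (- v \in K))%N else (#|K| - (- v \in K))%N.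
Proof.
move=> up vp; have [->|u0] := eqVneq u 0.
  have -> : [set w in Fp | w * 0 - w ^+ 2 * v \in K] =
      [set w in Fp :\ 0 | - v \in K].
    apply/setP => w; rewrite !inE mulr0 sub0r -mulrN andbC -andbA.
    have [->|w0] := eqVneq w 0; first by rewrite expr0n mul0r (negbTE K0).
    by rewrite andbC; case: (boolP (in_Fp p w)) => //= wp; rewrite Ksq ?inE.
  case: (- v \in K); last by rewrite muln0; apply: eq_card0 => w; rewrite !inE andbF.
  rewrite muln1 -card_Fp (cardsD1 0 Fp) Fp0 addKn; apply: eq_card => w.
  by rewrite !inE andbT.
have -> : (#|K| - (- v \in K))%N = #|[set z | (z \in K) && (z != - v)]|.
  rewrite (cardsD1 (- v) K) addKn; apply: eq_card => z.
  by rewrite !inE andbC.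
(* Since the inverse of 0 is 0, [w = 0] corresponds to [z = - v], and the substitution is a
   bijection of the whole field. *)
apply: (@card_set_bij _ (fun w => u / w - v) (fun z => u / (z + v))).
- by move=> w; rewrite subrK invf_div mulrC divfK.
- by move=> z; rewrite invf_div mulrC divfK // addrK.
move=> w; have [->|w0] := eqVneq w 0.
  by rewrite mul0r expr0n mul0r subr0 (negbTE K0) invr0 mulr0 sub0r eqxx !andbF.
have -> : w * u - w ^+ 2 * v = w ^+ 2 * (u / w - v) by field.
have -> : (u / w - v != - v) by rewrite -subr_eq0 opprK subrK mulf_neq0 ?invr_eq0.
rewrite andbT; case: (boolP (w \in Fp)) => [wp | /negP wp] /=; first by rewrite Ksq.
apply/esym/negP => /(subsetP KFp) /FpD /(_ vp); rewrite subrK => uw; apply: wp.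
by have := FpM up (FpV uw); rewrite invf_div mulrC divfK.
Qed.

(** * Length and weights in terms of [K] *)

Definition class_length := #|[set x | Tr (x ^+ p.+1 - x) \in K]|.

Definition class_weight a :=
  #|[set x | (Tr (x ^+ p.+1 - x) \in K) && (Tr (a * x) != 0)]|.

Lemma class_lengthE :
  class_length = ((p - 1) %/ 2 * p ^ (e - 1) + (p - 1) %/ 2 * p ^ (e %/ 2))%N.
Proof.
rewrite -mulnDr -cardK -(card_qform_in KFp) (negbTE K0) muln0 addn0.
apply: (@card_set_bij _ (fun x => x - 2^-1) (fun x => x + 2^-1)) => x.
- by rewrite subrK.
- by rewrite addrK.
by rewrite qform_shift.
Qed.

Lemma class_weight_complement a :
  (class_weight a + #|[set x | (Tr (x ^+ p.+1 - x)%R \in K) && (Tr (a * x)%R == 0%R)]|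
     = class_length)%N.
Proof.
rewrite /class_weight /class_length -[RHS](cardsID [set x | Tr (a * x) == 0]) addnC.
by congr addn; apply: eq_card => x; rewrite !inE // andbC.
Qed.

Let e_ge4 : (4 <= e)%N. Proof. exact: dvdn_leq. Qed.
Let pX1 : (p ^ (e - 1) = p * p ^ (e - 2))%N.
Proof. by rewrite -expnS; congr expn; move: e_ge4; clear; lia. Qed.
Let pX2 : (p ^ (e - 2) = p ^ 2 * p ^ (e - 4))%N.
Proof. by rewrite -expnD; congr expn; move: e_ge4; clear; lia. Qed.
Let pXm : (p ^ (e %/ 2) = p ^ 2 * p ^ (e %/ 2 - 2))%N.
Proof. by rewrite -expnD; congr expn; move: e_ge4; clear; lia. Qed.
Let pXm1 : (p ^ (e %/ 2) = p * p ^ (e %/ 2 - 1))%N.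
Proof. by rewrite -expnS; congr expn; move: e_ge4; clear; lia. Qed.
Let p_half := odd_halves p_odd (odd_prime_gt2 p_odd p_pr).

(** With [y = x - 2^-1], [Tr (polar_dual b * x)] becomes [polar y b + Tr b]. The zero coordinates
    are thus counted by [card_qform_in_polar] at [s = - Tr b], and the weight is the length minus
    their number. *)
Lemma class_weight_dual b : b \notin radical ->
  class_weight (polar_dual b) =
    (tW p e + p ^ (e %/ 2) * if Tr b == 0%R then (p - 1) * (- qform b \in K)%R
                             else #|K| - (- qform b \in K)%R)%N.
Proof.
move=> Rb; have := class_weight_complement (polar_dual b).
have -> : #|[set x | (Tr (x ^+ p.+1 - x) \in K) && (Tr (polar_dual b * x) == 0)]| =
    #|[set y | (qform y \in K) && (polar y b == - Tr b)]|.
  apply: (@card_set_bij _ (fun x => x - 2^-1) (fun x => x + 2^-1)) => x.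
  - by rewrite subrK.
  - by rewrite addrK.
  rewrite qform_shift -{2}[x](subrK 2^-1) mulrDr TrD -!polarE; congr (_ && _).
  have -> : polar 2^-1 b = Tr b.
    by rewrite -[2^-1]mulr1 polarZl // polarC polar1 mulKf ?two_neq0.
  by rewrite addr_eq0.
rewrite class_lengthE; have := card_qform_in_polar KFp Rb (FpN (Tr_Fp b)).
have -> : [set w in Fp | - (w * - Tr b + w ^+ 2 * qform b) \in K] =
    [set w in Fp | w * Tr b - w ^+ 2 * qform b \in K].
  by apply/setP => w; rewrite !inE opprD mulrN opprK.
rewrite card_Fp_quadratic ?Tr_Fp ?qform_Fp // cardK.
rewrite /tW pX1; have [h [h0 ph ->] [-> _ _ _]] := p_half.
move: (if _ then _ else _) => k; move: #|_| (class_weight _) (p ^ (e - 2))%N (p ^ _)%N.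
rewrite ph; clear => x y Z X; lia.
Qed.

Lemma class_weight_nondual a : a \notin polar_dual @: setT ->
  class_weight a = (tW p e + ((p - 1) ^ 2) %/ 2 * p ^ (e %/ 2 - 1))%N.
Proof.
case/radical_separates => r Rr Tar; have := class_weight_complement a.
set N := #|_|.
have pN : (p * N = class_length)%N.
  rewrite /class_length (@card_sum_fibers _ _ (fun x => Tr (a * x)) _ Fp) => [|x _].
    rewrite -[X in (X * _)%N]card_Fp -sum_nat_const; apply: eq_bigr => s sp.
    (* This element of the radical has [Tr (a * r0) = s]; translation by it preserves
       [qform (x - 2^-1)] and moves the fiber of 0 to that of [s]. *)
    pose r0 := s / Tr (a * r) * r.
    have Rr0 : r0 \in radical by rewrite radicalZ // FpM ?FpV ?Tr_Fp.
    have Tr0 : Tr (a * r0) = s.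
      have -> : a * r0 = s / Tr (a * r) * (a * r) by rewrite /r0; ring.
      by rewrite TrZ ?divfK ?FpM ?FpV ?Tr_Fp.
    apply: (@card_set_bij _ (fun x => x + r0) (fun x => x - r0)) => x.
    - by rewrite addrK.
    - by rewrite subrK.
    rewrite !inE !qform_shift addrAC (qform_addr _ Rr0) mulrDr TrD Tr0.
    by rewrite -[X in _ + s == X]add0r (inj_eq (addIr s)).
  exact: Tr_Fp.
have p_gt0 := prime_gt0 p_pr.
move: pN; rewrite class_lengthE.
rewrite /tW pX1 pXm1; have [h [h0 ph ->] [-> _ _ _]] := p_half.
rewrite !(mulnCA h) -mulnDr => /eqP; rewrite eqn_pmul2l // => /eqP ->.
move: (class_weight _) (p ^ (e - 2))%N (p ^ _)%N => x Z X.
by rewrite ph; clear; lia.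
Qed.

(* The values are positions in the lists [weights] and [freqs]. *)
Definition coset_class (b : F) : nat :=
  if b \in radical then 0%N
  else if Tr b == 0 then (if - qform b \in K then 4 else 2)%N
  else (if - qform b \in K then 5 else 3)%N.

Definition word_class (a : F) : nat :=
  if [pick b | polar_dual b == a] is Some b then coset_class b else 1%N.

(** Makes [word_class] independent of the preimage that [pick] selects. *)
Lemma coset_class_addr b r : r \in radical -> coset_class (b + r) = coset_class b.
Proof.
move=> Rr; rewrite /coset_class (qform_addr _ Rr) TrD (Tr_radical Rr) addr0.
by move: Rr; rewrite -!polar_dual_eq0 polar_dualD => /eqP->; rewrite addr0.
Qed.

Lemma word_class_dual b : word_class (polar_dual b) = coset_class b.
Proof.
rewrite /word_class; case: pickP => [c | /(_ b)]; last by rewrite eqxx.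
by rewrite polar_dual_eq => /(coset_class_addr b); rewrite addrC subrK.
Qed.

Lemma word_class_nondual a : a \notin polar_dual @: setT -> word_class a = 1%N.
Proof.
by rewrite /word_class; case: pickP => // c /eqP <- /imsetP[]; exists c.
Qed.

Lemma word_class_lt6 a : (word_class a < 6)%N.
Proof. by rewrite /word_class /coset_class; case: pickP => // b _; do ?case: ifP. Qed.

Lemma word_class_eq0 a : word_class a = 0%N -> a = 0.
Proof.
rewrite /word_class /coset_class; case: pickP => // b /eqP <-.
case: ifP => [Rb _ | _]; last by do ?case: ifP.
by apply/eqP; rewrite polar_dual_eq0.
Qed.

Lemma class_weightE a : class_weight a = nth 0%N (weights p e) (word_class a).
Proof.
have [/imsetP[b _ ->{a}] | im_a] := boolP (a \in polar_dual @: setT); last first.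
  by rewrite class_weight_nondual // word_class_nondual.
rewrite word_class_dual /coset_class.
have [Rb|Rb] := boolP (b \in radical).
  have /eqP -> : polar_dual b == 0 by rewrite polar_dual_eq0.
  by apply: eq_card0 => x; rewrite !inE mul0r Tr0 eqxx andbF.
rewrite class_weight_dual // cardK.
have [h [_ _ hE] [_ _ _ h1E]] := p_half; rewrite /weights h1E hE.
by do 2!case: ifP => _ /=; rewrite ?subn0 ?muln0 ?muln1 ?addn0 // mulnC.
Qed.

Lemma card_word_class (j : nat) : (j < 6)%N ->
  #|[set a | word_class a == j]| = nth 0%N (freqs p e) j.
Proof.
have p2_gt0 : (0 < p ^ 2)%N by rewrite expn_gt0 prime_gt0.
(* Outside class 1 every [a] has [p ^ 2] preimages under [polar_dual], so it suffices to count the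
   preimages. *)
have fiber i : i != 1%N ->
    (#|[set a | word_class a == i]| * p ^ 2 = #|[set b | coset_class b == i]|)%N.
  move=> i1; rewrite [RHS]card_polar_dual_preim => [|x r].
    congr (_ * _)%N; apply: eq_card => a; rewrite inE.
    apply/eqP/imsetP => [ai | [b]]; last first.
      by rewrite inE => /eqP <- ->; rewrite word_class_dual.
    have [/imsetP[b _ ab]|im_a] := boolP (a \in polar_dual @: setT).
      by exists b; rewrite // inE -word_class_dual -ab ai.
    by move: i1; rewrite -ai word_class_nondual.
  by rewrite inE => /eqP <- Rr; rewrite inE coset_class_addr.
have [h [_ ph hE] [sq1 p1 sq2 _]] := p_half.
have negK_Fp : [set t | - t \in K] \subset Fp.
  by apply/subsetP => t; rewrite inE => /(subsetP KFp); rewrite FpNE.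
have card_negK : #|[set t | - t \in K]| = h.
  rewrite -hE -cardK -[in RHS](card_imset _ (@oppr_inj F)); apply: eq_card => t.
  rewrite inE; apply/idP/imsetP => [Kt | [u Ku ->]]; last by rewrite opprK.
  by exists (- t); rewrite ?opprK.
have card_negKC : #|Fp :\: [set t | - t \in K]| = (h + 1)%N.
  by rewrite cardsD card_Fp (setIidPr negK_Fp) card_negK ph; clear; lia.
(* Here [b = 1] and [s = 0]; as [qform 1 = 0], the condition on [w] reduces to [0 \in L]. The case
   of nonzero trace follows by subtraction from the full count of [qform y \in L]. *)
have levels (L : {set F}) : L \subset Fp ->
    (#|[set y | (qform y \in L) && (Tr y == 0%R)]| + p * p ^ (e %/ 2) * (0%R \in L) =
       #|L| * (p ^ (e - 2) + p ^ (e %/ 2)))%N /\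
    #|[set y | (qform y \in L) && (Tr y != 0%R)]| = (#|L| * (2 * h) * p ^ (e - 2))%N.
  move=> LFp; have := card_qform_in_polar LFp one_notin_radical Fp0.
  have -> : [set w in Fp | - (w * 0 + w ^+ 2 * qform 1) \in L] =
      if 0 \in L then Fp else set0.
    apply/setP => w; rewrite inE qform1 !mulr0 addr0 oppr0.
    by case: ifP; rewrite ?andbT // andbF inE.
  have -> : #|if 0 \in L then Fp else set0| = (p * (0%R \in L))%N.
    by case: ifP; rewrite ?card_Fp ?muln1 // cards0 muln0.
  have -> : [set y | (qform y \in L) && (polar y 1 == 0)] =
      [set y | (qform y \in L) && (Tr y == 0)].
    by apply/setP => y; rewrite !inE polar1 mulf_eq0 (negbTE two_neq0).
  have := card_qform_in LFp.
  rewrite -(cardsID [set y | Tr y == 0] [set y | qform y \in L]) pX1.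
  have -> : [set y | qform y \in L] :&: [set y | Tr y == 0] =
    [set y | (qform y \in L) && (Tr y == 0)] by apply/setP => y; rewrite !inE.
  have -> : [set y | qform y \in L] :\: [set y | Tr y == 0] =
    [set y | (qform y \in L) && (Tr y != 0)].
    by apply/setP => y; rewrite !inE andbC.
  move: (p ^ (e %/ 2))%N (p ^ (e - 2))%N #|L| (nat_of_bool (0 \in L)) => X Z l c.
  by move: #|_| #|_| => u v; rewrite ph; clear => H1 H2; split; lia.
have neg0 : 0 \notin [set t | - t \in K] by rewrite inE oppr0.
have [negK_0 negK_1] := levels _ negK_Fp.
have [negKC_0 negKC_1] := levels _ (subsetDl Fp [set t | - t \in K]).
have mem_negK y : (qform y \in [set t | - t \in K]) = (- qform y \in K) by rewrite inE.
have mem_negKC y : (qform y \in Fp :\: [set t | - t \in K]) = (- qform y \notin K).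
  by rewrite in_setD mem_negK qform_Fp andbT.
have fiberE i n : i != 1%N -> #|[set b | coset_class b == i]| = (n * p ^ 2)%N ->
    #|[set a | word_class a == i]| = n.
  by move=> i1; rewrite -fiber // => /eqP; rewrite eqn_pmul2r // => /eqP.
rewrite /freqs hE sq1 p1 sq2; case: j => [|[|[|[|[|[|//]]]]]] _ /=.
- apply: fiberE => //; rewrite mul1n -card_radical; apply: eq_card => b.
  by rewrite inE /coset_class; case: (b \in radical) => //; do 2!case: ifP.
- have -> : [set a | word_class a == 1%N] = ~: (polar_dual @: setT).
    apply/setP => a; rewrite !inE; have [/imsetP[b _ ->]|im_a] := boolP (a \in _).
      by rewrite word_class_dual /coset_class; case: ifP => //; do 2!case: ifP.
    by rewrite word_class_nondual.
  rewrite cardsCs setCK cardF; congr subn; apply/eqP.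
  rewrite -(eqn_pmul2r p2_gt0) -card_polar_dual_preim => [|? ? _ _]; last by rewrite inE.
  by rewrite cardsT cardF -expnD subnK // (leq_trans _ e_ge4).
- apply: fiberE => //.
  (* The radical satisfies both conditions of this class but encodes the zero word; removing it
     produces the [- 1] in the frequency. *)
  have E : [set b | coset_class b == 2%N] =
      [set y | (- qform y \notin K) && (Tr y == 0)] :\: radical.
    apply/setP => b; rewrite inE in_setD inE /coset_class; case: (b \in radical) => //=.
    by case: (Tr b == 0); case: (- qform b \in K).
  have sub : radical \subset [set y | (- qform y \notin K) && (Tr y == 0)].
    apply/subsetP => r Rr; rewrite inE (Tr_radical Rr) (qform_radical Rr).
    by rewrite oppr0 K0 eqxx.
  have := subset_leq_card sub; rewrite E cardsD (setIidPr sub) card_radical.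
  move: negKC_0; rewrite in_setD neg0 Fp0 muln1 card_negKC pX2 pXm.
  under eq_finset do rewrite mem_negKC.
  move: #|_| (p ^ (e - 4))%N (p ^ (e %/ 2 - 2))%N => u Z X.
  move=> uE0 le_u; have {uE0} uE : (u + p ^ 2 * (p * X) = p ^ 2 * ((h + 1) * (Z + X)))%N.
    by move: uE0; move: (p ^ 2)%N; clear; lia.
  (* The other terms of the equation are multiples of [p ^ 2], hence so is [u]; dividing by [p ^ 2]
     first makes the subtraction of the radical a subtraction of 1. *)
  have := dvdn_mulr ((h + 1) * (Z + X)) (dvdnn (p ^ 2)).
  rewrite -uE (dvdn_addl _ (dvdn_mulr _ (dvdnn _))) => /dvdnP[v uv].
  move: uE; rewrite uv [(v * _)%N]mulnC -mulnDr => /eqP.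
  rewrite eqn_pmul2l // => /eqP vE.
  rewrite -{2}[(p ^ 2)%N]muln1 -mulnBr mulnC; congr muln.
  by move: vE; rewrite ph; clear; lia.
- apply: fiberE => //; have <- : [set y | (- qform y \notin K) && (Tr y != 0)] =
      [set b | coset_class b == 3%N].
    apply/setP => b; rewrite !inE /coset_class.
    have [Rb | Rb] := boolP (b \in radical); first by rewrite (Tr_radical Rb) eqxx andbF.
    by case: (Tr b == 0); case: (- qform b \in K).
  under eq_finset do rewrite -mem_negKC.
  by rewrite negKC_1 card_negKC pX2; move: (p ^ 2)%N (p ^ _)%N; clear; lia.
- apply: fiberE => //; have <- : [set y | (- qform y \in K) && (Tr y == 0)] =
      [set b | coset_class b == 4%N].
    apply/setP => b; rewrite !inE /coset_class.
    have [Rb | Rb] := boolP (b \in radical).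
      by rewrite (qform_radical Rb) oppr0 (negbTE K0).
    by case: (Tr b == 0); case: (- qform b \in K).
  under eq_finset do rewrite -mem_negK.
  move: negK_0; rewrite (negbTE neg0) muln0 addn0 => ->; rewrite card_negK pX2 pXm.
  by move: (p ^ 2)%N (p ^ _)%N (p ^ _)%N; clear; lia.
apply: fiberE => //; have <- : [set y | (- qform y \in K) && (Tr y != 0)] =
    [set b | coset_class b == 5%N].
  apply/setP => b; rewrite !inE /coset_class.
  have [Rb | Rb] := boolP (b \in radical); first by rewrite (Tr_radical Rb) eqxx andbF.
  by case: (Tr b == 0); case: (- qform b \in K).
under eq_finset do rewrite -mem_negK.
by rewrite negK_1 card_negK pX2; move: (p ^ 2)%N (p ^ _)%N; clear; lia.
Qed.

End TraceForm.

(** * Transfer of the counts from field elements to codewords *)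

Theorem theorem7 (F : finFieldType) (p e : nat) (i : 'I_2)
  (p_prime : prime p) (p_odd : odd p)
  (e_gt0 : (0 < e)%N) (e_mod4 : (4 %| e)%N) (p_dvd_e : (p %| e)%N)
  (cardF : #|F| = (p ^ e)%N) :
  [/\ #|@Dset F p e i| = ((p - 1) %/ 2 * p ^ (e - 1) + (p - 1) %/ 2 * p ^ (e %/ 2))%N,
      #|@code F p e i| = (p ^ e)%N,
      (forall c, c \in @code F p e i -> wt c \in weights p e) &
      (forall w, @nwt F p e i w =
         \sum_(j < 6 | nth 0%N (weights p e) j == w) nth 0%N (freqs p e) j)%N].
Proof.
pose K := class_set F p i.
have KFp : K \subset Fp F p by apply: class_set_sub.
have K0 : 0 \notin K by apply: class_set0.
have cardK : #|K| = ((p - 1) %/ 2)%N by apply: card_class_set cardF _ _.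
have Ksq c t : c \in Fp F p -> c != 0 -> (c ^+ 2 * t \in K) = (t \in K).
  exact: class_set_sq.
have wtE (a : F) : wt (codeword p e i a) = nth 0%N (weights p e) (word_class p e K a).
  rewrite -(class_weightE p_prime e_gt0 cardF p_odd e_mod4 p_dvd_e KFp K0 cardK Ksq).
  apply: eq_card => x; rewrite !inE ffunE !inE.
  by case: ifP => _; rewrite ?eqxx.
have cls6 (a : F) : (word_class p e K a < 6)%N by apply: word_class_lt6.
(* If [a] and [b] give the same word, then [a - b] gives one of weight 0. As [tW p e > 0], only
   position 0 of the table has weight 0, and its class consists of 0 alone. *)
have cw_inj : injective (@codeword F p e i).
  move=> a b ab; apply/eqP; rewrite -subr_eq0; apply/eqP.
  have : wt (codeword p e i (a - b)) = 0%N.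
    apply: eq_card0 => x; rewrite !in_set ffunE; case: ifP => [Dx|_]; last by rewrite eqxx.
    have := congr1 (fun c : {ffun F -> F} => c x) ab; rewrite !ffunE Dx => Tab.
    by rewrite mulrBl (TrD p_prime cardF) (TrN p_prime cardF) Tab subrr eqxx.
  rewrite wtE => w0; apply: (@word_class_eq0 F p e p_prime e_gt0 cardF K).
  have tW_gt0 : (0 < tW p e)%N.
    have [h [h0 _ _] [hE _ _ _]] := odd_halves p_odd (odd_prime_gt2 p_odd p_prime).
    by rewrite /tW hE !muln_gt0 h0 expn_gt0 (prime_gt0 p_prime).
  have := cls6 (a - b); move: w0 tW_gt0; rewrite /weights.
  by case: (word_class _ _ _ _) => [|[|[|[|[|[|]]]]]] //=; case: (tW p e).
split.
- rewrite -(class_lengthE p_prime e_gt0 cardF p_odd e_mod4 p_dvd_e KFp K0 cardK).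
  by apply: eq_card => x; rewrite !inE.
- by rewrite card_imset // cardF.
- by move=> _ /imsetP[a _ ->]; rewrite wtE mem_nth.
move=> w; rewrite /nwt.
have -> : [set c in code F p e i | wt c == w] =
    codeword p e i @: [set a | wt (codeword p e i a) == w].
  apply/setP => c; rewrite inE; apply/andP/imsetP => [[/imsetP[a _ ->] wa] | [a]].
    by exists a; rewrite ?inE.
  by rewrite inE => wa ->; rewrite imset_f.
(* Distinct positions can carry the same weight, for instance 2 and 5 when [p = 3], so words are
   sorted by class and the classes of weight [w] are summed. *)
rewrite card_imset // (@card_sum_fibers _ _ (fun a => Ordinal (cls6 a)) _ setT) //.
rewrite [RHS]big_mkcond; apply: eq_big => [j | j _]; first by rewrite inE.
rewrite -(card_word_class p_prime e_gt0 cardF p_odd e_mod4 p_dvd_e KFp K0 cardK) //.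
case: ifP => [/eqP wj | wj].
  apply: eq_card => a; rewrite !inE wtE -val_eqE /= andb_idl // => /eqP->.
  by rewrite wj.
apply: eq_card0 => a; rewrite !inE wtE -val_eqE /=.
by apply/negP => /andP[wa /eqP aj]; rewrite -aj wa in wj.
Qed.
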